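(* Let $k\ge 4$. For any $K_k$-minor-free multigraph $G$ of maximum degree $\Delta$, the strong clique number of $G$ satisfies $\omega_2'(G)\le \frac32(k-2)\Delta$.
   Context: Multigraphs may have parallel edges; degree counts multiplicity. A multigraph is $K_k$-minor-free if its underlying simple graph has no $K_k$ minor. A strong clique of a multigraph $G$ is a set of edges every two of which are incident (share an endpoint; parallel edges are incident) or are joined by an edge of $G$ (some edge of $G$ has one endpoint in common with each of them). The strong clique number $\omega_2'(G)$ is the maximum size of a strong clique (counting parallel edges separately). *)

(* Defs.v *)
From HB Require Import structures.
From mathcomp Require Import all_boot all_order all_algebra.

Set Implicit Arguments.
Unset Strict Implicit.
Unset Printing Implicit Defensive.

(* Finite loopless multigraphs: parallel edges are distinct elements of
   [edge] with the same [ends]. *)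
Record multigraph := Multigraph {
  vertex : finType;
  edge : finType;
  ends : edge -> {set vertex};
  card_ends : forall e, #|ends e| = 2
}.

Definition degree (G : multigraph) (v : vertex G) : nat :=
  #|[set e : edge G | v \in ends e]|.

Definition max_degree (G : multigraph) : nat :=
  \max_(v : vertex G) degree v.

Definition underlying (G : multigraph) : rel (vertex G) :=
  fun u v => [exists e : edge G, ends e == [set u; v]].

Lemma underlying_sym (G : multigraph) : symmetric (@underlying G).
Proof. by move=> u v; apply: eq_existsb => e; rewrite setUC. Qed.

Lemma underlying_irrefl (G : multigraph) : irreflexive (@underlying G).
Proof.
move=> u; apply/existsP => -[e /eqP De].
by have := card_ends e; rewrite De setUid cards1.
Qed.

(* Below, simple graphs are symmetric irreflexive relations on a finType. *)

Definition complete (k : nat) : rel 'I_k := fun i j => i != j.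

Definition induced_connected (T : finType) (g : rel T) (A : {set T}) : Prop :=
  A != set0 /\
  {in A &, forall x y,
     connect [rel u v | [&& u \in A, v \in A & g u v]] x y}.

(* [B] is the family of branch sets of a model of [h] in [g]. *)
Definition has_minor (S T : finType) (h : rel S) (g : rel T) : Prop :=
  exists B : S -> {set T},
    [/\ forall i, induced_connected g (B i),
        forall i j, i != j -> [disjoint B i & B j]
      & forall i j, h i j -> exists x y, [/\ x \in B i, y \in B j & g x y]].

Definition K_minor_free (k : nat) (G : multigraph) : Prop :=
  ~ has_minor (@complete k) (@underlying G).

Definition incident (G : multigraph) (e f : edge G) : bool :=
  ends e :&: ends f != set0.

Definition joined (G : multigraph) (e f : edge G) : bool :=
  [exists g : edge G, incident g e && incident g f].

Definition strong_clique (G : multigraph) (S : {set edge G}) : bool :=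
  [forall e in S, forall f in S, (e != f) ==> incident e f || joined e f].

Definition strong_clique_number (G : multigraph) : nat :=
  \max_(S : {set edge G} | strong_clique S) #|S|.

(* Main.v *)
Require Import Defs.
From HB Require Import structures.
From mathcomp Require Import all_boot all_order all_algebra all_fingroup.
From mathcomp Require Import zify lra.

Set Implicit Arguments.
Unset Strict Implicit.
Unset Printing Implicit Defensive.

(* Let h be the simple graph supporting a strong clique S.  By Koenig's theorem
   on the bipartite double cover of h, 2|S| <= N * Delta, where N is the largest
   number of vertices x with h x (s x), over all permutations s.  Assume
   N >= 3k - 5.  The cycles of s contain a matching of h with at least N / 3
   edges, hence at least k - 1; as disjoint edges of h are joined by an edge,
   these edges are the branch sets of a clique minor.  If there are only k - 1
   of them, then nearly all cycles of s are triangles, and one more branch set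
   is needed.  Except for an isolated heptagon it can be a star, formed by a
   vertex v of an odd cycle and one neighbour of v in each of some triangles:
   removing a vertex from a triangle leaves an edge, so the other branch sets
   survive, and a counting argument finds a v whose star sees all of them,
   because a triangle or edge missed by one end of an edge of h is seen by the
   other end. *)

(** * Koenig's theorem on matchings and vertex covers of bipartite graphs *)

Section Konig.
Variables T U : finType.
Implicit Types (E M : {set T * U}) (A : {set T}) (B : {set U}).

Definition covers E A B := [forall e in E, (e.1 \in A) || (e.2 \in B)].

Lemma coversP E A B :
  reflect (forall x y, (x, y) \in E -> (x \in A) || (y \in B)) (covers E A B).
Proof.
apply: (iffP forall_inP) => [cE x y /cE //|cE [x y]]; exact: cE.
Qed.

(* If two edges share an end, then the smaller covers obtained by removing
   either one of them recombine, by submodularity, into a cover of [E] with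
   fewer than [n] vertices. *)
Lemma edge_critical_matching E n :
    (forall A B, covers E A B -> n <= #|A| + #|B|) ->
    (forall e, e \in E -> exists A B, covers (E :\ e) A B /\ #|A| + #|B| < n) ->
  {in E &, injective fst} /\ {in E &, injective snd}.
Proof.
move=> lbE critE; split=> [] [x v] [y w] eE fE /= xy;
  subst; apply/eqP; apply: contraT => nef;
  have [A1 [B1 [/coversP c1 lt1]]] := critE _ eE;
  have [A2 [B2 [/coversP c2 lt2]]] := critE _ fE.
(* With fewer than [n] vertices, a cover of [E] minus an edge at [y] cannot contain [y]: it would
   cover the deleted edge too. *)
- have nA A B u : covers (E :\ (y, u)) A B -> #|A| + #|B| < n -> y \notin A.
    move=> /coversP cA ltn; apply/negP => yA; suff /lbE : covers E A B by lia.
    apply/coversP => a b abE; have [/eqP[-> _]|ne] := boolP ((a, b) == (y, u)).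
      by rewrite yA.
    by apply: cA; rewrite !inE ne.
  have /negPf y1 : y \notin A1 by apply: (nA _ B1 v) => //; apply/coversP.
  have /negPf y2 : y \notin A2 by apply: (nA _ B2 w) => //; apply/coversP.
  have ineq1 : n <= #|A1 :&: A2| + #|B1 :|: B2|.
    apply/lbE/coversP => a b abE; rewrite !inE.
    have [eqe|ne] := eqVneq (a, b) (y, v).
      have := c2 _ _ (_ : (a, b) \in E :\ (y, w)).
      rewrite eqe !inE nef eE => /(_ isT); case: eqe => -> ->.
      by rewrite y2 /= => ->; rewrite ?orbT.
    have := c1 a b; rewrite !inE ne abE => /(_ isT).
    have [eqf|ne'] := eqVneq (a, b) (y, w).
      by case: eqf => -> ->; rewrite y1 /= => ->; rewrite ?orbT.
    have := c2 a b; rewrite !inE ne' abE => /(_ isT).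
    by do 4!case: (_ \in _).
  have ineq2 : n <= #|y |: (A1 :|: A2)| + #|B1 :&: B2|.
    apply/lbE/coversP => a b abE; rewrite !inE.
    have [//|ay] := eqVneq a y.
    have := c1 a b; have := c2 a b; rewrite !inE !xpair_eqE (negPf ay) abE /=.
    by move=> /(_ isT) + /(_ isT); do 4!case: (_ \in _).
  (* The two recombined covers have at most [2 * (n - 1) + 1] vertices in all, the extra one being
     [y], yet each has at least [n]. *)
  have := cardsUI A1 A2; have := cardsUI B1 B2.
  have := cardsU1 y (A1 :|: A2); lia.
- have nB A B u : covers (E :\ (u, w)) A B -> #|A| + #|B| < n -> w \notin B.
    move=> /coversP cA ltn; apply/negP => wB; suff /lbE : covers E A B by lia.
    apply/coversP => a b abE; have [/eqP[_ ->]|ne] := boolP ((a, b) == (u, w)).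
      by rewrite wB orbT.
    by apply: cA; rewrite !inE ne.
  have /negPf w1 : w \notin B1 by apply: (nB A1 _ x) => //; apply/coversP.
  have /negPf w2 : w \notin B2 by apply: (nB A2 _ y) => //; apply/coversP.
  have ineq1 : n <= #|A1 :|: A2| + #|B1 :&: B2|.
    apply/lbE/coversP => a b abE; rewrite !inE.
    have [eqe|ne] := eqVneq (a, b) (x, w).
      have := c2 _ _ (_ : (a, b) \in E :\ (y, w)).
      rewrite eqe !inE nef eE => /(_ isT); case: eqe => -> ->.
      by rewrite w2 orbF => ->; rewrite ?orbT.
    have := c1 a b; rewrite !inE ne abE => /(_ isT).
    have [eqf|ne'] := eqVneq (a, b) (y, w).
      by case: eqf => -> ->; rewrite w1 orbF => ->.
    have := c2 a b; rewrite !inE ne' abE => /(_ isT).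
    by do 4!case: (_ \in _).
  have ineq2 : n <= #|A1 :&: A2| + #|w |: (B1 :|: B2)|.
    apply/lbE/coversP => a b abE; rewrite !inE.
    have [|bw] := eqVneq b w; first by rewrite orbT.
    have := c1 a b; have := c2 a b; rewrite !inE !xpair_eqE.
    rewrite (negPf bw) !andbF abE ?orbT.
    by move=> /(_ isT) + /(_ isT); do 4!case: (_ \in _).
  have := cardsUI A1 A2; have := cardsUI B1 B2.
  have := cardsU1 w (B1 :|: B2); lia.
Qed.

(** Edges whose deletion preserves the bound on covers are dropped one by one. When none is left to
    drop, [E] is a matching, and its left ends form a cover, so it has at least [n] edges. *)
Lemma konig_lower_bound E n :
    (forall A B, covers E A B -> n <= #|A| + #|B|) ->
  exists M, [/\ M \subset E, {in M &, injective fst},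
                {in M &, injective snd} & n <= #|M|].
Proof.
move eqm: #|E| => m; elim: m E eqm => [|m IHm] E eqm lbE.
  exists E; have E0 := cards0_eq eqm; rewrite subxx eqm E0.
  by split=> [//|x y|x y|]; rewrite ?inE //; have := lbE set0 set0;
     rewrite E0 !cards0; apply; apply/forall_inP => x; rewrite inE.
have [/exists_inP[e eE /'forall_forallP lbe]|crit] := boolP [exists e in E,
    [forall A, forall B, covers (E :\ e) A B ==> (n <= #|A| + #|B|)]].
  have [||M [ME M1 M2 Mn]] := IHm (E :\ e).
  - by have := cardsD1 e E; rewrite eE eqm add1n => -[].
  - by move=> A B; apply/implyP/lbe.
  - by exists M; split=> //; apply: subset_trans ME (subsetDl _ _).
have [|M1 M2] := @edge_critical_matching E n lbE.
  move=> e eE; move: crit; rewrite negb_exists_in => /forall_inP/(_ e eE).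
  rewrite negb_forall => /existsP[A]; rewrite negb_forall => /existsP[B].
  by rewrite negb_imply -ltnNge => /andP[]; exists A, B.
exists E; split=> //; have := lbE [set e.1 | e in E] set0.
rewrite cards0 addn0 => /(_ _)/leq_trans; apply; last exact: leq_imset_card.
by apply/forall_inP => e eE; rewrite imset_f.
Qed.

Lemma konig E :
  exists M A B, [/\ M \subset E, {in M &, injective fst},
     {in M &, injective snd}, covers E A B & #|A| + #|B| <= #|M|].
Proof.
pose X := ([set: T], [set: U]).
have cT : covers E X.1 X.2 by apply/forall_inP => e _; rewrite inE.
case: (arg_minnP (P := fun X : {set T} * {set U} => covers E X.1 X.2)
  (fun X => #|X.1| + #|X.2|) cT) => -[A B] /= cAB minAB.
have [|M [ME M1 M2 leM]] := @konig_lower_bound E (#|A| + #|B|).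
  by move=> A' B' cAB'; apply: (minAB (A', B')).
by exists M, A, B.
Qed.
End Konig.

(** By induction, a permutation that suits the other pairs is followed by the transposition of [s x]
    and [y]; this moves none of their values because [M] is injective on both sides. *)
Lemma perm_extends (T : finType) (M : {set T * T}) :
    {in M &, injective fst} -> {in M &, injective snd} ->
  exists s : {perm T}, forall x y, (x, y) \in M -> s x = y.
Proof.
move eqm: #|M| => m; elim: m M eqm => [|m IHm] M eqm M1 M2.
  by exists 1%g => x y; rewrite (cards0_eq eqm) inE.
have /card_gt0P[[x y] xyM] : 0 < #|M| by rewrite eqm.
have sub : {subset M :\ (x, y) <= M} by apply/subsetP/subsetDl.
have [|||s sM] := IHm (M :\ (x, y)).
- by have := cardsD1 (x, y) M; rewrite xyM eqm add1n => -[].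
- by move=> e f /sub eM /sub; apply: M1.
- by move=> e f /sub eM /sub; apply: M2.
exists (s * tperm (s x) y)%g => a b abM; rewrite permM.
have [[-> ->]|ne] := eqVneq (a, b) (x, y); first by rewrite tpermL.
have sa : s a = b by apply: sM; rewrite !inE ne.
rewrite sa tpermD //; apply: contraNneq ne => eqb.
  by apply/eqP/M1 => //=; apply: (@perm_inj _ s); rewrite sa -eqb.
by apply/eqP/M2.
Qed.

(** * Disjoint cliques as branch sets of a clique minor *)

Section CliqueModels.
Variables (V : finType) (h g : rel V).
Implicit Types (A B Q : {set V}) (P K : {set {set V}}).

(** Two vertices are required so that every clique contains an edge of [h]; this makes disjoint
    cliques adjacent in [g]. *)
Definition hclique A :=
  (1 < #|A|) && [forall x in A, forall y in A, (x != y) ==> h x y].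

Definition packing P := trivIset P && [forall A in P, hclique A].

Definition clique_model K :=
  (forall A, A \in K -> induced_connected g A) /\
  (forall A B, A \in K -> B \in K -> A != B ->
     [disjoint A & B] /\ exists x y, [/\ x \in A, y \in B & g x y]).

Definition misses (v : V) A := [forall x in A, ~~ g v x].

Definition pairs P := [set A in P | #|A| == 2].

Lemma clique_model_minor K k :
  clique_model K -> k <= #|K| -> has_minor (@complete k) g.
Proof.
move=> [conK adjK] lek; pose B (i : 'I_k) := enum_val (widen_ord lek i).
have neqB i j : i != j -> B i != B j.
  by apply: contra_neq => /enum_val_inj/(congr1 val)/= /val_inj.
exists B; split=> [i|i j ij|i j ij].
- exact/conK/enum_valP.
- by have [] := adjK _ _ (enum_valP (widen_ord lek i))
    (enum_valP (widen_ord lek j)) (neqB _ _ ij).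
- by have [] := adjK _ _ (enum_valP (widen_ord lek i))
    (enum_valP (widen_ord lek j)) (neqB _ _ ij).
Qed.

Hypothesis h_sym : symmetric h.
Hypothesis h_irr : irreflexive h.
Hypothesis h_sub : subrel h g.
Hypothesis g_sym : symmetric g.
(** This is what remains of the strong clique property when [h] is the support of the clique and [g]
    the underlying graph. *)
Hypothesis linked : forall a b c d, h a b -> h c d ->
  [disjoint [set a; b] & [set c; d]] -> [|| g a c, g a d, g b c | g b d].

Lemma hcliqueP A : hclique A -> forall x y, x \in A -> y \in A -> x != y -> h x y.
Proof.
move=> /andP[_ /forall_inP cA] x y xA yA; move: (cA _ xA) => /forall_inP.
by move=> /(_ _ yA)/implyP.
Qed.

Lemma hclique_pair A : hclique A ->
  exists a b, [/\ a \in A, b \in A, a != b & h a b].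
Proof.
move=> cA; have /andP[/card_gt1P[a [b [aA bA ab]]] _] := cA.
by exists a, b; split=> //; apply: (hcliqueP cA).
Qed.

Lemma hclique_sub A B : hclique A -> B \subset A -> 1 < #|B| -> hclique B.
Proof.
move=> cA /subsetP BA B1; rewrite /hclique B1; apply/forall_inP => x /BA xA.
by apply/forall_inP => y /BA yA; apply/implyP/(hcliqueP cA).
Qed.

Lemma hclique2 a b : h a b -> hclique [set a; b].
Proof.
move=> hab; have ab : a != b by apply: contraTneq hab => ->; rewrite h_irr.
rewrite /hclique cards2 ab; apply/forall_inP => x xab.
apply/forall_inP => y; move: xab; rewrite !inE.
by move=> /orP[] /eqP-> /orP[] /eqP->;
  rewrite ?eqxx ?hab ?implybT // h_sym hab implybT.
Qed.

Lemma hclique3 a b c : h a b -> h b c -> h c a -> hclique [set a; b; c].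
Proof.
move=> hab hbc hca.
have ab : a != b by apply: contraTneq hab => ->; rewrite h_irr.
rewrite /hclique setUC.
rewrite (leq_trans _ (subset_leq_card (subsetUr _ _))) ?cards2 ?ab //.
apply/forall_inP => x xab; apply/forall_inP => y; move: xab; rewrite !inE.
by move=> /or3P[] /eqP-> /or3P[] /eqP->; rewrite ?eqxx //; apply/implyP => _ //;
  rewrite h_sym.
Qed.

Lemma hclique_connected A : hclique A -> induced_connected g A.
Proof.
move=> cA; split=> [|x y xA yA].
  by case/andP: cA => + _; rewrite -card_gt0 => /ltnW.
have [->//|xy] := eqVneq x y; apply: connect1.
by rewrite /= xA yA (h_sub (hcliqueP cA _ _ xy)).
Qed.

Lemma star_connected Q v : v \in Q ->
  {in Q, forall x, x != v -> g v x} -> induced_connected g Q.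
Proof.
move=> vQ star; split=> [|x y xQ yQ]; first by apply/set0Pn; exists v.
apply: (@connect_trans _ _ v).
  have [->//|xv] := eqVneq x v; apply: connect1.
  by rewrite /= xQ vQ g_sym star.
have [->//|yv] := eqVneq y v; apply: connect1.
by rewrite /= vQ yQ star.
Qed.

Lemma hclique_adjacent A B : hclique A -> hclique B -> [disjoint A & B] ->
  exists x y, [/\ x \in A, y \in B & g x y].
Proof.
move=> /hclique_pair[a [b [aA bA _ hab]]] /hclique_pair[c [d [cB dB _ hcd]]] dAB.
have dis : [disjoint [set a; b] & [set c; d]].
  by apply: disjointW dAB; apply/subsetP => x; rewrite !inE => /orP[] /eqP->.
by case/or4P: (linked hab hcd dis) => gxy;
  [exists a, c|exists a, d|exists b, c|exists b, d].
Qed.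

Lemma packing_hclique P A : packing P -> A \in P -> hclique A.
Proof. by case/andP=> _ /forall_inP; apply. Qed.

Lemma packing_trivIset P : packing P -> trivIset P.
Proof. by case/andP. Qed.

Lemma packing_disjoint P A B :
  packing P -> A \in P -> B \in P -> A != B -> [disjoint A & B].
Proof. by case/andP=> /trivIsetP tP _; apply: tP. Qed.

Lemma packing_eq P A B x :
  packing P -> A \in P -> B \in P -> x \in A -> x \in B -> A = B.
Proof.
move=> pP AP BP xA xB; apply/eqP; apply: contraTT xB => neq.
by rewrite (disjointFr (packing_disjoint pP AP BP neq)).
Qed.

Lemma notin_cover P x A : x \notin cover P -> A \in P -> x \notin A.
Proof. by move=> xP AP; apply: contra xP => xA; apply/bigcupP; exists A. Qed.

Lemma packing_clique_model P : packing P -> clique_model P.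
Proof.
move=> pP; split=> [A /(packing_hclique pP)/hclique_connected //|A B AP BP neq].
have dAB := packing_disjoint pP AP BP neq; split=> //.
by apply: hclique_adjacent => //; apply: (packing_hclique pP).
Qed.

Lemma packingU1 P A : packing P -> hclique A -> [disjoint A & cover P] ->
  packing (A |: P) /\ A \notin P.
Proof.
move=> pP cA dA; have AP : A \notin P.
  have [a [_ [aA _ _ _]]] := hclique_pair cA; apply: contraL aA => AP.
  apply/negP => aA; have := disjointFr dA aA.
  by move/negbT/notin_cover/(_ AP); rewrite aA.
split=> //; apply/andP; split; last first.
  by apply/forall_inP => B; rewrite !inE => /orP[/eqP->//|]; apply: packing_hclique.
apply/trivIsetP => B C; rewrite !inE.
have dis D : D \in P -> [disjoint A & D].
  by move=> DP; apply: disjointWr dA; apply: bigcup_sup DP.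
move=> /orP[/eqP->|BP] /orP[/eqP->|CP]; rewrite ?eqxx // => neq.
- exact: dis.
- by rewrite disjoint_sym dis.
- exact: (packing_disjoint pP).
Qed.

Lemma missesPn v A : reflect (exists2 x, x \in A & g v x) (~~ misses v A).
Proof.
rewrite negb_forall_in; apply: (iffP exists_inP) => -[x xA vx]; exists x => //.
  by rewrite negbK in vx.
by rewrite negbK.
Qed.

Lemma missesP v A x : misses v A -> x \in A -> g v x = false.
Proof. by move=> /forall_inP mA /mA/negbTE. Qed.

(** In [linked] for the edges [u v] and [x y], the joining edge cannot start at [u], so it starts at
    [v]. Hence [v] is nonadjacent to at most one vertex of [A]. *)
Lemma adjacent_misses u v A x y : h u v -> u \notin A -> v \notin A ->
  hclique A -> misses u A -> x \in A -> y \in A -> x != y -> g v x || g v y.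
Proof.
move=> huv uA vA cA mu xA yA xy.
have dis : [disjoint [set u; v] & [set x; y]].
  rewrite disjoints_subset; apply/subsetP => z zuv; rewrite !inE negb_or.
  by move: zuv; rewrite !inE => /orP[] /eqP->; apply/andP; split;
    [apply: contraNneq uA|apply: contraNneq uA|apply: contraNneq vA
    |apply: contraNneq vA] => ->.
have := linked huv (hcliqueP cA xA yA xy) dis.
by rewrite (missesP mu xA) (missesP mu yA).
Qed.

Lemma adjacent_not_misses u v A : h u v -> u \notin A -> v \notin A ->
  hclique A -> misses u A -> ~~ misses v A.
Proof.
move=> huv uA vA cA mu; have [a [b [aA bA ab _]]] := hclique_pair cA.
by apply/missesPn; case/orP: (adjacent_misses huv uA vA cA mu aA bA ab);
  [exists a|exists b].
Qed.

Lemma inj_into_set (T : finType) (X Y : {set T}) : #|X| <= #|Y| ->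
  exists f : T -> T, {in X &, injective f} /\ {in X, forall x, f x \in Y}.
Proof.
move=> leXY; pose f x := nth x (enum Y) (index x (enum X)); exists f.
have lt x : x \in X -> index x (enum X) < size (enum Y).
  by move=> xX; rewrite -cardE (leq_trans _ leXY) // cardE index_mem mem_enum.
split=> [x y xX yX|x xX]; last by rewrite -mem_enum mem_nth ?lt.
rewrite /f (set_nth_default y) ?lt // => /eqP.
rewrite nth_uniq ?lt ?enum_uniq // => /eqP eqi.
by rewrite -(@nth_index _ x x (enum X)) ?mem_enum // eqi nth_index ?mem_enum.
Qed.

(** * An extra branch set in the shape of a star *)

Definition missed v P := [set A in P | misses v A].
(** A good clique can lend a vertex to the star and remain a clique. Two neighbours of [v] are asked
    for because one of them may miss the clique that the star has to reach. *)
Definition good v P :=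
  [set A in P | (2 < #|A|) && (1 < #|[set x in A | g v x]|)].

Lemma clique_modelU1 K A : clique_model K -> induced_connected g A ->
    (forall B, B \in K -> [disjoint A & B]) ->
    (forall B, B \in K -> exists x y, [/\ x \in A, y \in B & g x y]) ->
  clique_model (A |: K) /\ #|A |: K| = #|K|.+1.
Proof.
move=> [conK adjK] conA disA adjA; have AK : A \notin K.
  apply/negP => AK; have [/set0Pn[a aA] _] := conA.
  by have := disjointFr (disA A AK) aA; rewrite aA.
split; last by rewrite cardsU1 AK.
split=> [B|B C]; rewrite !inE; first by case/orP => [/eqP->|/conK].
move=> /orP[/eqP->|BK] /orP[/eqP->|CK]; rewrite ?eqxx // => neq.
- by split; [apply: disA|apply: adjA].
- split; first by rewrite disjoint_sym disA.
  by have [x [y [xA yB gxy]]] := adjA B BK; exists y, x; rewrite g_sym.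
- exact: adjK.
Qed.

(* The extra branch set is a star: [v] together with, for each clique [A]
   missed by [v], a neighbour of [v] that sees [A], taken from a large clique
   that does not serve any other missed clique. *)
Lemma star_clique_model P v :
    packing P -> v \notin cover P -> #|missed v P| <= #|good v P| ->
  exists K, clique_model K /\ #|K| = #|P|.+1.
Proof.
move=> pP vP /inj_into_set[phi [phi_inj phiG]].
have /fin_all_exists[w wP] : forall A : {set V}, exists w, A \in missed v P ->
    [/\ w \in phi A, g v w & ~~ misses w A].
  move=> A; have [AM|_] := boolP (A \in missed v P); last by exists v.
  have := phiG A AM; rewrite inE => /and3P[pAP _ /card_gt1P].
  move=> [w1 [w2 []]]; rewrite !inE => /andP[w1A vw1] /andP[w2A vw2] w12.
  have := AM; rewrite inE => /andP[AP mA].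
  have neq : phi A != A.
    by apply: contraTneq vw1 => eqA; rewrite (missesP mA) // -eqA.
  have dis := packing_disjoint pP pAP AP neq.
  have [m1|] := boolP (misses w1 A); last by exists w1.
  (* [w1] and [w2] are adjacent in [h], so they cannot both miss [A]. *)
  exists w2; split=> //; apply: adjacent_not_misses m1.
  - exact: (hcliqueP (packing_hclique pP pAP)).
  - by rewrite (disjointFr dis).
  - by rewrite (disjointFr dis).
  - exact: (packing_hclique pP).
pose Q := v |: [set w A | A in missed v P].
have memQ A x : A \in P -> x \in A -> x \in Q ->
    exists B, [/\ B \in missed v P, phi B = A & x = w B].
  move=> AP xA; rewrite !inE => /orP[/eqP xv|/imsetP[B BM xB]].
    by have := notin_cover vP AP; rewrite -xv xA.
  have [wB _ _] := wP B BM; exists B; split=> //.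
  have := phiG B BM; rewrite inE => /and3P[pBP _ _].
  by apply: (packing_eq pP pBP AP wB); rewrite -xB.
have AQ1 A : A \in P -> #|A :&: Q| <= 1.
  move=> AP; apply/card_le1_eqP => x y; rewrite !in_setI.
  move=> /andP[xA xQ] /andP[yA yQ].
  have [B [BM eB ->]] := memQ A x AP xA xQ.
  have [C [CM eC ->]] := memQ A y AP yA yQ.
  by rewrite (phi_inj B C) ?eB.
(* A clique that loses a vertex is some [phi B]: it has at least three vertices and loses only
   one. *)
have clA A : A \in P -> hclique (A :\: Q).
  move=> AP; have cA := packing_hclique pP AP.
  apply: (hclique_sub cA); first exact: subsetDl.
  have [x|Q0] := pickP (mem (A :&: Q)).
    rewrite /= in_setI => /andP[xA xQ]; have := cardsID Q A; have := AQ1 A AP.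
    have [B [BM eB _]] := memQ A x AP xA xQ.
    have := phiG B BM; rewrite eB inE => /and3P[_ A3 _]; lia.
  by have := cardsID Q A; rewrite (eq_card0 Q0) add0n => ->; case/andP: cA.
pose R := [set A :\: Q | A in P].
have injR : {in P &, injective (fun A => A :\: Q)}.
  move=> A B AP BP eAB; have [a [_ [aA _ _ _]]] := hclique_pair (clA A AP).
  have := aA; rewrite eAB; move: aA; rewrite !inE => /andP[_ aA] /andP[_ aB].
  exact: (packing_eq pP AP BP aA aB).
have pR : packing R.
  apply/andP; split; last by apply/forall_inP => _ /imsetP[A AP ->]; apply: clA.
  apply/trivIsetP => _ _ /imsetP[A AP ->] /imsetP[B BP ->] neq.
  have /(packing_disjoint pP AP BP) : A != B by apply: contra_neq neq => ->.
  by apply: disjointW; apply: subsetDl.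
have dQ A : A \in R -> [disjoint Q & A].
  move=> /imsetP[B _ ->]; rewrite disjoint_sym disjoints_subset.
  by apply/subsetP => x; rewrite !inE => /andP[].
have vQ : v \in Q by rewrite !inE eqxx.
have conQ : induced_connected g Q.
  apply: (star_connected vQ) => x; rewrite !inE => /orP[/eqP->|/imsetP[A AM ->] _].
    by rewrite eqxx.
  by have [] := wP A AM.
(* If [B] lent a vertex to [Q], that vertex is adjacent to the rest of [B]; otherwise [B] is intact
   and is seen by [v], or by [w B] if [v] misses it. *)
have adjQ A : A \in R -> exists x y, [/\ x \in Q, y \in A & g x y].
  move=> /imsetP[B BP ->]; have [a [b [aB _ _ _]]] := hclique_pair (clA B BP).
  move: aB; rewrite inE => /andP[aQ aB].
  have [x|Q0] := pickP (mem (B :&: Q)).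
    rewrite /= in_setI => /andP[xB xQ]; exists x, a; rewrite xQ inE aQ aB.
    split=> //; apply/h_sub/(hcliqueP (packing_hclique pP BP)) => //.
    by apply: contraNneq aQ => <-.
  have inD y : y \in B -> y \in B :\: Q.
    by move=> yB; have := Q0 y; rewrite /= in_setI in_setD yB /= => ->.
  have [mB|/missesPn[y yB vy]] := boolP (misses v B); last first.
    by exists v, y; rewrite vQ inD.
  have BM : B \in missed v P by rewrite inE BP.
  have [_ _ /missesPn[y yB wy]] := wP B BM; exists (w B), y.
  by rewrite inD // !inE imset_f ?orbT.
have [mK cK] := clique_modelU1 (packing_clique_model pR) conQ dQ adjQ.
by exists (Q |: R); rewrite cK card_in_imset.
Qed.

(** * Stars centred on triangles, pentagons and heptagons *)

Definition large P := [set A in P | 2 < #|A|].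

Lemma card_missed P v : packing P ->
  #|missed v P| = #|missed v (large P)| + #|missed v (pairs P)|.
Proof.
move=> pP; rewrite -(cardsID (large P)).
congr (_ + _); apply: eq_card => A; rewrite !inE.
  by case: (A \in P) => //=; rewrite andbC.
have [AP|] := boolP (A \in P); rewrite ?andbF //=.
have /andP[A2 _] := packing_hclique pP AP.
by congr (_ && _); lia.
Qed.

(** By [adjacent_misses], [v] is nonadjacent to at most one vertex of a clique missed by [u], so it
    sees at least two of three or more. *)
Lemma missed_large_good P u v : packing P -> h u v ->
  u \notin cover P -> v \notin cover P -> missed u (large P) \subset good v P.
Proof.
move=> pP huv uP vP; apply/subsetP => A; rewrite !inE.
move=> /andP[/andP[AP A3] mA]; rewrite AP A3 /= ltnNge; apply/negP => le1.
have := cardsID [set x | g v x] A; rewrite -setIdE => cA.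
have /card_gt1P[x [y []]] : 1 < #|A :\: [set x | g v x]| by lia.
rewrite !inE => /andP[vx xA] /andP[vy yA] xy.
have := adjacent_misses huv (notin_cover uP AP) (notin_cover vP AP)
  (packing_hclique pP AP) mA xA yA xy.
by rewrite (negPf vx) (negPf vy).
Qed.

Lemma disjoint_missed P u v : packing P -> h u v ->
  u \notin cover P -> v \notin cover P -> [disjoint missed u P & missed v P].
Proof.
move=> pP huv uP vP; rewrite disjoints_subset; apply/subsetP => A.
rewrite !inE => /andP[AP mA]; rewrite AP /=.
exact: adjacent_not_misses (notin_cover uP AP) (notin_cover vP AP)
  (packing_hclique pP AP) mA.
Qed.

Lemma missed_sub P P' v : P \subset P' -> missed v P \subset missed v P'.
Proof.
by move=> /subsetP sP; apply/subsetP => A; rewrite !inE => /andP[/sP-> ->].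
Qed.

Lemma good_sub P P' v : P \subset P' -> good v P \subset good v P'.
Proof.
by move=> /subsetP sP; apply/subsetP => A; rewrite !inE => /andP[/sP-> ->].
Qed.

Lemma coverU1 P A : cover (A |: P) = A :|: cover P.
Proof. by rewrite /cover bigcup_setU big_set1. Qed.

Lemma missedU1 P A v : ~~ misses v A -> missed v (A |: P) = missed v P.
Proof.
move=> mA; apply/setP => B; rewrite !inE.
by have [->|//] := eqVneq B A; rewrite (negPf mA) !andbF.
Qed.

Lemma packing_edgeU1 P a b : packing P -> h a b ->
    a \notin cover P -> b \notin cover P ->
  packing ([set a; b] |: P) /\ #|[set a; b] |: P| = #|P|.+1.
Proof.
move=> pP hab aP bP.
have [|pP' nP] := packingU1 pP (hclique2 hab).
  rewrite disjoints_subset; apply/subsetP => x.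
  by rewrite !inE => /orP[] /eqP->.
by rewrite cardsU1 nP.
Qed.

(* The second alternative says that the star centred at [v] is not available. *)
Lemma triangle_apex P v b c :
    packing P -> h v b -> h b c -> h c v ->
    v \notin cover P -> b \notin cover P -> c \notin cover P ->
  (exists K, clique_model K /\ #|K| = #|P| + 2) \/
  #|missed b (large P)| + #|missed c (large P)| <
    #|missed v (large P)| + #|missed v (pairs P)|.
Proof.
move=> pP hvb hbc hcv vP bP cP.
have [pP' cP'] := packing_edgeU1 pP hbc bP cP.
have [le|lt] := leqP #|missed v P| #|good v P|.
  left; have [|| K [mK cK]] := star_clique_model (v := v) pP'.
  - rewrite coverU1 !inE !negb_or vP andbT; apply/andP; split.
      by apply: contraTneq hvb => ->; rewrite h_irr.
    by apply: contraTneq hcv => ->; rewrite h_irr.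
  - rewrite missedU1 ?(leq_trans le) //.
      exact/subset_leq_card/good_sub/subsetUr.
    by apply/missesPn; exists b; rewrite ?inE ?eqxx // h_sub.
  - by exists K; rewrite cK cP' addn2.
(* No clique is missed by both [b] and [c], and the large ones missed by either are good for [v]. *)
right; rewrite -card_missed //; apply: leq_ltn_trans lt.
have dis := disjoint_missed pP hbc bP cP.
have sL : large P \subset P by apply/subsetP => A; rewrite inE => /andP[].
have := disjointW (missed_sub b sL) (missed_sub c sL) dis.
rewrite -leq_card_setU => /eqP <-; apply: subset_leq_card; rewrite subUset.
by rewrite !missed_large_good // h_sym.
Qed.

(** If the stars at [a], [b] and [c] all fail, the sum of the three inequalities of [triangle_apex]
    gives at least three misses of pairs. A pair is missed by at most one of the three vertices, so
    there are exactly three pairs and each vertex misses exactly one, which the last hypothesis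
    excludes. *)
Lemma triangle_clique_model P a b c :
    packing P -> h a b -> h b c -> h c a ->
    a \notin cover P -> b \notin cover P -> c \notin cover P ->
    #|pairs P| <= 3 -> #|pairs P| <= 2 \/ #|missed a (pairs P)| != 1 ->
  exists K, clique_model K /\ #|K| = #|P| + 2.
Proof.
move=> pP hab hbc hca aP bP cP le3 le2.
have sL : pairs P \subset P by apply/subsetP => A; rewrite inE => /andP[].
have dis u v : h u v -> u \notin cover P -> v \notin cover P ->
    [disjoint missed u (pairs P) & missed v (pairs P)].
  move=> huv uP vP; have := disjoint_missed pP huv uP vP.
  exact: disjointW (missed_sub u sL) (missed_sub v sL).
have : #|missed a (pairs P)| + #|missed b (pairs P)| + #|missed c (pairs P)|
    <= #|pairs P|.
  have := dis _ _ hab aP bP; rewrite -leq_card_setU => /eqP <-.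
  have : [disjoint missed a (pairs P) :|: missed b (pairs P)
           & missed c (pairs P)].
    by rewrite -setI_eq0 setIUl setU_eq0 !setI_eq0 [X in X && _]disjoint_sym !dis.
  rewrite -leq_card_setU => /eqP <-; apply: subset_leq_card.
  by apply/subsetP => A; rewrite !inE => /orP[/orP[]|] /andP[].
have [//|la] := triangle_apex pP hab hbc hca aP bP cP.
have [//|lb] := triangle_apex pP hbc hca hab bP cP aP.
have [//|lc] := triangle_apex pP hca hab hbc cP aP bP.
by move: le3 le2 la lb lc; clear; lia.
Qed.

Lemma pentagon_apex P (v0 v1 v2 v3 v4 : V) (s := [:: v0; v1; v2; v3; v4]) :
    packing P -> path.cycle h s -> uniq s -> {in s, forall v, v \notin cover P} ->
  (exists K, clique_model K /\ #|K| = #|P| + 3) \/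
  #|missed v1 (large P)| < #|missed v0 (large P)| + #|missed v0 (pairs P)|.
Proof.
rewrite {}/s => pP /= /and5P[h01 h12 h23 h34 /andP[h40 _]].
rewrite !inE !negb_or -!andbA => /and5P[n01 n02 n03 n04].
move=> /and5P[n12 n13 n14 n23 /and3P[n24 n34 _]] outP.
have out v : v \in [:: v0; v1; v2; v3; v4] -> v \notin cover P by apply: outP.
have [|| p1 c1] := packing_edgeU1 pP h34; rewrite ?out ?inE ?eqxx ?orbT //.
have [|| p2 c2] := packing_edgeU1 p1 h12; rewrite ?coverU1 ?inE.
- by rewrite (negPf n13) (negPf n14) out // !inE eqxx orbT.
- by rewrite (negPf n23) (negPf n24) out // !inE eqxx !orbT.
have [le|lt] := leqP #|missed v0 P| #|good v0 P|.
  left; have [|| K [mK cK]] := star_clique_model (v := v0) p2.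
  - rewrite !coverU1 !inE (negPf n01) (negPf n02) (negPf n03) (negPf n04).
    by rewrite out // !inE eqxx.
  - rewrite !missedU1 ?(leq_trans le) //.
    + by apply/subset_leq_card/good_sub; rewrite setUA subsetUr.
    + apply/missesPn; exists v4; first by rewrite !inE eqxx orbT.
      by rewrite h_sub // h_sym.
    + apply/missesPn; exists v1; first by rewrite !inE eqxx.
      by rewrite h_sub.
  - by exists K; rewrite cK c2 c1 -addn3.
right; rewrite -card_missed //; apply: leq_ltn_trans lt.
apply/subset_leq_card/missed_large_good => //; first by rewrite h_sym.
  by rewrite out // !inE eqxx orbT.
by rewrite out // !inE eqxx.
Qed.

Lemma card_missed_sum P v : #|missed v P| = \sum_(A in P) misses v A.
Proof.
rewrite -sum1_card big_mkcond [RHS]big_mkcond; apply: eq_bigr => A _.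
by rewrite inE; case: (A \in P); case: misses.
Qed.

(** If all five rotations fail, the terms for large cliques cancel around the cycle and at least
    five misses of pairs remain. But no two consecutive vertices miss the same pair, so each pair is
    missed at most twice, and two pairs allow only four misses. *)
Lemma pentagon_clique_model P (s : seq V) :
    packing P -> path.cycle h s -> uniq s -> {in s, forall v, v \notin cover P} ->
    size s = 5 -> #|pairs P| <= 2 ->
  exists K, clique_model K /\ #|K| = #|P| + 3.
Proof.
move=> pP; case: s => [//|v0 [//|v1 [//|v2 [//|v3 [//|v4 [|//]]]]]] cyc un out _.
move=> le2; pose s := [:: v0; v1; v2; v3; v4].
have step i : [/\ path.cycle h (rot i s), uniq (rot i s) &
    {in rot i s, forall v, v \notin cover P}].
  by rewrite rot_cycle rot_uniq; split=> // v; rewrite mem_rot; apply: out.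
have eps A : A \in pairs P -> misses v0 A + misses v1 A + misses v2 A
    + misses v3 A + misses v4 A <= 2.
  rewrite inE => /andP[AP _]; have cA := packing_hclique pP AP.
  have mis u v : h u v -> u \in s -> v \in s -> misses u A + misses v A <= 1.
    move=> huv us vs; have := adjacent_not_misses huv
      (notin_cover (out u us) AP) (notin_cover (out v vs) AP) cA.
    by case: (misses u A) => [/(_ isT)/negPf->|]; case: (misses v A).
  have /and5P[h01 h12 h23 h34 /andP[h40 _]] := cyc.
  have := mis _ _ h01; have := mis _ _ h12; have := mis _ _ h23.
  have := mis _ _ h34; have := mis _ _ h40; rewrite !inE !eqxx !orbT.
  move=> /(_ isT isT) + /(_ isT isT) + /(_ isT isT) + /(_ isT isT) + /(_ isT isT).
  by do 5!case: (misses _ A).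
have : #|missed v0 (pairs P)| + #|missed v1 (pairs P)| + #|missed v2 (pairs P)|
   + #|missed v3 (pairs P)| + #|missed v4 (pairs P)| <= 4.
  rewrite !card_missed_sum -!big_split /=.
  apply: leq_trans (_ : \sum_(A in pairs P) 2 <= _); first exact: leq_sum.
  by rewrite sum_nat_const; lia.
have [c0 u0 o0] := step 0; have [//|l0] := pentagon_apex pP c0 u0 o0.
have [c1 u1 o1] := step 1; have [//|l1] := pentagon_apex pP c1 u1 o1.
have [c2 u2 o2] := step 2; have [//|l2] := pentagon_apex pP c2 u2 o2.
have [c3 u3 o3] := step 3; have [//|l3] := pentagon_apex pP c3 u3 o3.
have [c4 u4 o4] := step 4; have [//|l4] := pentagon_apex pP c4 u4 o4.
by move: l0 l1 l2 l3 l4; clear; lia.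
Qed.

Lemma heptagon_edges P (v0 v1 v2 v3 v4 v5 v6 : V)
    (s := [:: v0; v1; v2; v3; v4; v5; v6])
    (P' := [set v1; v2] |: ([set v3; v4] |: ([set v5; v6] |: P))) :
    packing P -> path.cycle h s -> uniq s -> {in s, forall v, v \notin cover P} ->
  [/\ packing P', #|P'| = #|P| + 3, v0 \notin cover P',
      #|pairs P'| = #|pairs P| + 3 &
      forall a, #|missed a (pairs P')| = #|missed a (pairs P)| +
        (misses a [set v1; v2] + misses a [set v3; v4] + misses a [set v5; v6])].
Proof.
rewrite {}/s {}/P' => pP /= /and5P[h01 h12 h23 h34 /and4P[h45 h56 h60 _]].
rewrite !inE !negb_or -!andbA.
move=> /and5P[n01 n02 n03 n04 /and5P[n05 n06 n12 n13 /and5P[n14 n15 n16 n23]]].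
move=> /and5P[n24 n25 n26 n34 /and5P[n35 n36 n45 n46 /andP[n56 _]]] outP.
have out v : v \in [:: v0; v1; v2; v3; v4; v5; v6] -> v \notin cover P.
  exact: outP.
have pU (R : {set {set V}}) x y :
    packing R -> h x y -> x \notin cover R -> y \notin cover R ->
  [/\ packing ([set x; y] |: R), #|[set x; y] |: R| = #|R| + 1,
     #|pairs ([set x; y] |: R)| = #|pairs R| + 1 &
     forall a, #|missed a (pairs ([set x; y] |: R))|
       = #|missed a (pairs R)| + misses a [set x; y]].
  move=> pR hxy xR yR; have [pR' cR'] := packing_edgeU1 pR hxy xR yR.
  have nR : [set x; y] \notin pairs R.
    rewrite inE negb_and; apply/orP; left.
    by apply: contra xR => eR; apply/bigcupP; exists [set x; y]; rewrite ?inE ?eqxx.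
  have xy : x != y by apply: contraTneq hxy => ->; rewrite h_irr.
  have pE : pairs ([set x; y] |: R) = [set x; y] |: pairs R.
    apply/setP => A; rewrite !inE andb_orl; have [->|//] := eqVneq A [set x; y].
    by rewrite cards2 xy.
  split=> // [||a]; first by rewrite cR' addn1.
    by rewrite pE cardsU1 nR addnC.
  by rewrite pE !card_missed_sum big_setU1 //= addnC.
have [|| p1 c1 q1 m1] := pU P v5 v6 pP h56; rewrite ?out ?inE ?eqxx ?orbT //.
have [|| p2 c2 q2 m2] := pU _ v3 v4 p1 h34; rewrite ?coverU1 ?inE.
- by rewrite (negPf n35) (negPf n36) out // !inE eqxx !orbT.
- by rewrite (negPf n45) (negPf n46) out // !inE eqxx !orbT.
have [|| p3 c3 q3 m3] := pU _ v1 v2 p2 h12; rewrite ?coverU1 ?inE.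
- rewrite (negPf n15) (negPf n16) (negPf n13) (negPf n14) out //.
  by rewrite !inE eqxx !orbT.
- rewrite (negPf n25) (negPf n26) (negPf n23) (negPf n24) out //.
  by rewrite !inE eqxx !orbT.
split=> [||||a]; first exact: p3.
- by rewrite c3 c2 c1 -!addnA.
- rewrite !negb_or n01 n02 n03 n04 n05 n06 out //.
  by rewrite !inE eqxx.
- by rewrite q3 q2 q1 -!addnA.
- rewrite m3 m2 m1 -!addnA; congr (_ + _).
  by rewrite [LHS]addnC [X in X + _ = _]addnC addnA.
Qed.

(* If no choice of the three edges works, then [a] misses exactly one edge of
   each of the seven near-perfect matchings of the heptagon, so three times the
   number of edges it misses is seven. *)
Lemma triangle_heptagon_clique_model P a b c (s : seq V) :
    packing P -> pairs P = set0 -> h a b -> h b c -> h c a ->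
    path.cycle h s -> uniq s -> size s = 7 ->
    {in s, forall v, v \notin cover P} ->
    [/\ a \notin cover P, b \notin cover P & c \notin cover P] ->
    [/\ a \notin s, b \notin s & c \notin s] ->
  exists K, clique_model K /\ #|K| = #|P| + 5.
Proof.
move=> pP prP hab hbc hca cyc un s7 out [aP bP cP] [nas nbs ncs].
have aux (v0 v1 v2 v3 v4 v5 v6 : V) (t := [:: v0; v1; v2; v3; v4; v5; v6]) :
    path.cycle h t -> uniq t -> s =i t ->
  (exists K, clique_model K /\ #|K| = #|P| + 5) \/
  misses a [set v1; v2] + misses a [set v3; v4] + misses a [set v5; v6] = 1.
  move=> cyct unt st.
  have [|pP' cP' _ prP' mP'] := heptagon_edges pP cyct unt.
    by move=> v vt; apply: out; rewrite st.
  move: prP' mP' (mP' a); rewrite prP cards0 => prP' mP'.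
  have -> : missed a set0 = set0 by apply/setP => A; rewrite !inE.
  rewrite cards0 !add0n => ma.
  have outP' x : x \notin cover P -> x \notin s ->
      x \notin cover ([set v1; v2] |: ([set v3; v4] |: ([set v5; v6] |: P))).
    rewrite st !coverU1 !inE !negb_or => ->.
    by do 7!case: (x != _).
  have [|ne1] := eqVneq #|missed a (pairs
      ([set v1; v2] |: ([set v3; v4] |: ([set v5; v6] |: P))))| 1.
    by rewrite ma; right.
  (* The three edges of the heptagon are the only pairs now, so it suffices that [a] does not miss
     exactly one of them. *)
  left; have [|||||K [mK cK]] := triangle_clique_model pP' hab hbc hca.
  - exact: outP'.
  - exact: outP'.
  - exact: outP'.
  - by rewrite prP'.
  - by right.
  - by exists K; rewrite cK cP' -addnA.
move: cyc un s7 aux {out nas nbs ncs}.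
case: s => [//|v0 [//|v1 [//|v2 [//|v3 [//|v4 [//|v5 [//|v6 [|//]]]]]]]].
set s := [:: v0; v1; v2; v3; v4; v5; v6] => cyc un _ aux.
have step i : [/\ path.cycle h (rot i s), uniq (rot i s) & s =i rot i s].
  by rewrite rot_cycle rot_uniq; split=> // v; rewrite mem_rot.
have [c0 u0 o0] := step 0; have [//|l0] := aux _ _ _ _ _ _ _ c0 u0 o0.
have [c1 u1 o1] := step 1; have [//|l1] := aux _ _ _ _ _ _ _ c1 u1 o1.
have [c2 u2 o2] := step 2; have [//|l2] := aux _ _ _ _ _ _ _ c2 u2 o2.
have [c3 u3 o3] := step 3; have [//|l3] := aux _ _ _ _ _ _ _ c3 u3 o3.
have [c4 u4 o4] := step 4; have [//|l4] := aux _ _ _ _ _ _ _ c4 u4 o4.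
have [c5 u5 o5] := step 5; have [//|l5] := aux _ _ _ _ _ _ _ c5 u5 o5.
have [c6 u6 o6] := step 6; have [//|l6] := aux _ _ _ _ _ _ _ c6 u6 o6.
by move: l0 l1 l2 l3 l4 l5 l6; clear; lia.
Qed.

Lemma packing0 : packing set0.
Proof.
apply/andP; split; last by apply/forall_inP => A; rewrite inE.
by apply/trivIsetP => A B; rewrite inE.
Qed.

(** Over the empty packing the star has no triangle to borrow from and is [v0] alone. It sees two of
    the three edges through [v1] and [v6], so it fails only by missing [v3 v4]. *)
Lemma heptagon_apex (v0 v1 v2 v3 v4 v5 v6 : V)
    (s := [:: v0; v1; v2; v3; v4; v5; v6]) :
    path.cycle h s -> uniq s ->
  (exists K, clique_model K /\ #|K| = 4) \/ ~~ g v0 v3 && ~~ g v0 v4.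
Proof.
move=> cyc un; have [|pP cP vP _ _] := heptagon_edges packing0 cyc un.
  by move=> v _; rewrite /cover big_set0 inE.
have /= /and5P[h01 h12 h23 h34 /and4P[h45 h56 h60 _]] := cyc.
have [m34|] := boolP (misses v0 [set v3; v4]).
  by right; rewrite !(missesP m34) ?inE ?eqxx ?orbT.
move=> m34; left; have [|K [mK cK]] := star_clique_model pP vP; last first.
  by exists K; rewrite cK cP cards0.
rewrite !missedU1 //; last 1 first.
- by apply/missesPn; exists v1; rewrite ?inE ?eqxx // h_sub.
- by rewrite (_ : missed _ _ = set0) ?cards0 //; apply/setP => A; rewrite !inE.
- by apply/missesPn; exists v6; rewrite ?inE ?eqxx ?orbT // h_sub // h_sym.
Qed.

(** If single-vertex stars fail at the first five vertices, these are nonadjacent to the two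
    vertices opposite them. Then [linked] forces some chords of length two, which give a model of
    order four. *)
Lemma heptagon_clique_model (s : seq V) :
    path.cycle h s -> uniq s -> size s = 7 ->
  exists K, clique_model K /\ #|K| = 4.
Proof.
case: s => [//|v0 [//|v1 [//|v2 [//|v3 [//|v4 [//|v5 [//|v6 [|//]]]]]]]].
set s := [:: v0; v1; v2; v3; v4; v5; v6] => cyc un _.
have step i : path.cycle h (rot i s) /\ uniq (rot i s).
  by rewrite rot_cycle rot_uniq.
have [c0 u0] := step 0; have [//|/andP[n03 n04]] := heptagon_apex c0 u0.
have [c1 u1] := step 1; have [//|/andP[n14 n15]] := heptagon_apex c1 u1.
have [c2 u2] := step 2; have [//|/andP[n25 n26]] := heptagon_apex c2 u2.
have [c3 u3] := step 3; have [//|/andP[n36 n30]] := heptagon_apex c3 u3.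
have [c4 u4] := step 4; have [//|/andP[n40 n41]] := heptagon_apex c4 u4.
have /= /and5P[h01 h12 h23 h34 /and4P[h45 h56 h60 _]] := cyc.
have dis a b c d : [&& a != c, a != d, b != c & b != d] ->
    [disjoint [set a; b] & [set c; d]].
  move=> /and4P[ac ad bc bd]; rewrite disjoints_subset; apply/subsetP => x.
  by rewrite !inE negb_or => /orP[] /eqP->; apply/andP.
have := un; rewrite /= !inE !negb_or -!andbA.
move=> /and5P[n01 n02 m03 m04 /and5P[n05 n06 n12 n13 /and5P[m14 m15 n16 n23]]].
move=> /and5P[n24 m25 m26 n34 /and5P[n35 m36 n45 n46 /andP[n56 _]]].
(* Of the four pairs linking [v6 v0] to [v2 v3], all but [v0 v2] are at cyclic distance three. *)
have g02 : g v0 v2.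
  have := linked h60 h23; rewrite [g v6 _]g_sym [g v6 v3]g_sym.
  rewrite (negPf n26) (negPf n36) (negPf n03) orbF; apply; apply: dis.
  by rewrite m03 n02 ![v6 == _]eq_sym m26 m36.
have g13 : g v1 v3.
  have := linked h01 h34.
  rewrite (negPf n03) (negPf n04) (negPf n14) orbF; apply; apply: dis.
  by rewrite m03 m04 n13 m14.
have g46 : g v4 v6.
  have := linked h34 h60; rewrite (negPf n36) (negPf n30) (negPf n40) orbF.
  by apply; apply: dis; rewrite m36 n46 ![_ == v0]eq_sym m03 m04.
have con1 v : induced_connected g [set v].
  by apply: (star_connected (set11 v)) => x; rewrite inE => /eqP->; rewrite eqxx.
(* The other branch sets are the single vertices [v0], [v1] and [v2]; here [v3] is adjacent to [v1]
   and [v2], and [v6] to [v0]. *)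
have con3 : induced_connected g [set v3; v4; v6].
  apply: (@star_connected _ v4); first by rewrite !inE eqxx orbT.
  by move=> x; rewrite !inE -orbA => /or3P[] /eqP->;
    rewrite ?eqxx // g_sym ?h_sub // g_sym.
have m0 : clique_model set0 by split=> [A|A B]; rewrite inE.
have [||m1 k1] := clique_modelU1 m0 con3; try by move=> A; rewrite inE.
have [||m2 k2] := clique_modelU1 m1 (con1 v2).
- move=> B; rewrite !inE orbF => /eqP->.
  by rewrite disjoints1 !inE !negb_or n23 n24 m26.
- move=> B; rewrite !inE orbF => /eqP->; exists v2, v3.
  by rewrite !inE !eqxx h_sub.
have [||m3 k3] := clique_modelU1 m2 (con1 v1).
- move=> B; rewrite !inE orbF => /orP[] /eqP->; rewrite disjoints1 !inE //.
  by rewrite !negb_or n13 m14 n16.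
- move=> B; rewrite !inE orbF => /orP[] /eqP->.
    by exists v1, v2; rewrite !inE !eqxx h_sub.
  by exists v1, v3; rewrite !inE !eqxx.
have [||m4 k4] := clique_modelU1 m3 (con1 v0).
- move=> B; rewrite !inE orbF => /or3P[] /eqP->; rewrite disjoints1 !inE //.
  by rewrite !negb_or m03 m04 n06.
- move=> B; rewrite !inE orbF => /or3P[] /eqP->.
  + by exists v0, v1; rewrite !inE !eqxx h_sub.
  + by exists v0, v2; rewrite !inE !eqxx.
  + by exists v0, v6; rewrite !inE !eqxx !orbT g_sym h_sub.
by eexists; split; [exact: m4|rewrite k4 k3 k2 k1 cards0].
Qed.
End CliqueModels.

(** * Matchings in the cycles of a permutation *)

Section CyclePackings.
Variables (V : finType) (h : rel V) (s : {perm V}).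
Hypothesis h_sym : symmetric h.
Hypothesis h_irr : irreflexive h.
Implicit Types (O : {set V}) (F : {set {set V}}).

(** [s] need not follow [h] everywhere; a vertex [x] stands here for the arc from [x] to [s x]. *)
Definition arcs O := [set x in O | h x (s x)].
Definition odd_cycle O := odd #|O| && [forall x in O, h x (s x)].

Lemma iter_porbit_inj x i j : i < #|porbit s x| -> j < #|porbit s x| ->
  iter i s x = iter j s x -> i = j.
Proof.
move=> li lj; rewrite -(nth_traject _ li) -(nth_traject _ lj) => /eqP.
by rewrite nth_uniq ?size_traject ?uniq_traject_porbit // => /eqP.
Qed.

Lemma iter_in_porbit x i : iter i s x \in porbit s x.
Proof. by rewrite -permX mem_porbit. Qed.

(** Arcs at positions of one parity along the orbit are disjoint. The condition [j.+1 < n] leaves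
    out the closing arc, which would meet the first one when [n] is odd. *)
Lemma alternating_packing x (b : bool) (n := #|porbit s x|)
    (J := [set j : 'I_n | [&& odd j == b, j.+1 < n &
             h (iter j s x) (iter j.+1 s x)]]) :
  exists F, [/\ packing h F, cover F \subset porbit s x,
    forall A, A \in F -> #|A| = 2 & #|F| = #|J|].
Proof.
pose e (j : nat) := [set iter j s x; iter j.+1 s x].
have eJ (j : 'I_n) : j \in J -> h (iter j s x) (iter j.+1 s x).
  by rewrite inE => /and3P[].
have common (i j : 'I_n) y : i \in J -> j \in J -> y \in e i -> y \in e j ->
    i = j.
  rewrite !inE => /and3P[/eqP oi li _] /and3P[/eqP oj lj _] yi yj.
  apply/val_inj => /=.
  have li' := ltnW li; have lj' := ltnW lj.
  have oij : odd i = odd j by rewrite oi oj.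
  have inj a c la lc eac := @iter_porbit_inj x a c la lc eac.
  move: yi yj => /orP[] /eqP-> /orP[] /eqP eqij.
  - exact: (inj _ _ li' lj' eqij).
  - by move: oij; rewrite (inj _ _ li' lj eqij) /=; case: odd.
  - by move: oij; rewrite -(inj _ _ li lj' eqij) /=; case: odd.
  - by case: (inj _ _ li lj eqij).
exists [set e j | j : 'I_n in J]; split.
- apply/andP; split; last first.
    by apply/forall_inP => _ /imsetP[j jJ ->]; apply: hclique2 => //; apply: eJ.
  apply/trivIsetP => _ _ /imsetP[i iJ ->] /imsetP[j jJ ->] neq.
  rewrite disjoints_subset; apply/subsetP => y yi; rewrite inE.
  by apply: contra neq => yj; rewrite (common i j y).
- apply/bigcupsP => _ /imsetP[j _ ->]; apply/subsetP => y.
  by rewrite !inE => /orP[] /eqP->;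
    rewrite ?iter_in_porbit // -iterS iter_in_porbit.
- move=> _ /imsetP[j jJ ->]; rewrite cards2; case: eqP => // eqj.
  by have := eJ j jJ; rewrite -eqj h_irr.
- rewrite card_in_imset // => i j iJ jJ eqij.
  apply: (common i j (iter i s x)) => //.
    by rewrite !inE eqxx.
  by rewrite -eqij !inE eqxx.
Qed.

Lemma card_arcs_porbit x (n := #|porbit s x|) :
  #|arcs (porbit s x)| =
  #|[set j : 'I_n | h (iter j s x) (iter j.+1 s x)]|.
Proof.
rewrite -[RHS](card_in_imset (f := fun j : 'I_n => iter j s x)); last first.
  by move=> i j _ _ /iter_porbit_inj eqij; apply/val_inj/eqij => /=.
apply: eq_card => y; rewrite inE porbit_traject.
apply/andP/imsetP => [[/trajectP[j lj ->] hj]|[j]].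
  by exists (Ordinal lj); rewrite ?inE.
rewrite inE => hj ->; split=> //; apply/trajectP.
by exists (val j); first exact: ltn_ord.
Qed.

Lemma card_pair_packing O F : packing h F -> cover F \subset O ->
  (forall A, A \in F -> #|A| = 2) -> 2 * #|F| <= #|O|.
Proof.
move=> /andP[/eqP tF _] /subset_leq_card; rewrite -tF => le F2.
by move: le; rewrite (eq_bigr (fun=> 2)) // sum_nat_const mulnC.
Qed.

(** The larger parity class has at least half of the non-closing arcs. If some arc is not in [h],
    the traversal starts just after it, so that it becomes the closing one and nothing is lost. If
    all arcs are in [h], the bound [2 * #|F| <= #|O|] and parity show that only an odd cycle loses
    an arc. *)
Lemma orbit_packing O : O \in porbits s ->
  exists F, [/\ packing h F, cover F \subset O,
    forall A, A \in F -> #|A| = 2 &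
    if odd_cycle O then #|O| = 2 * #|F| + 1 else #|arcs O| <= 2 * #|F|].
Proof.
move=> /imsetP[x0 _ eO].
have split_arcs x : porbit s x = O -> exists F, [/\ packing h F,
    cover F \subset O, forall A, A \in F -> #|A| = 2 &
    #|arcs O| <= 2 * #|F| + (h (iter #|O|.-1 s x) x)].
  move=> xO; have [F0 [p0 c0 s0 e0]] := alternating_packing x false.
  have [F1 [p1 c1 s1 e1]] := alternating_packing x true.
  suff le : #|arcs O| <= #|F0| + #|F1| + h (iter #|O|.-1 s x) x.
    rewrite -xO; have [le01|lt10] := leqP #|F0| #|F1|.
      by exists F1; split=> //; move: le le01; rewrite xO; clear; lia.
    by exists F0; split=> //; move: le lt10; rewrite xO; clear; lia.
  rewrite -{1}xO card_arcs_porbit e0 e1; set n := #|porbit s x|.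
  have -> : h (iter #|O|.-1 s x) x = h (iter n.-1 s x) (iter n.-1.+1 s x).
    by rewrite -xO prednK ?iter_porbit // lt0n card_porbit_neq0.
  set A0 := finset _; set J0 := finset _; set J1 := finset _.
  pose X := [set j : 'I_n | (j.+1 == n) && h (iter j s x) (iter j.+1 s x)].
  have leX : #|X| <= h (iter n.-1 s x) (iter n.-1.+1 s x).
    have lastX j : j \in X -> val j = n.-1.
      by rewrite inE => /andP[/eqP/(congr1 predn)].
    have X1 : #|X| <= 1.
      apply/card_le1_eqP => i j /lastX ni /lastX nj.
      by apply/val_inj; rewrite ni nj.
    have [hl|nhl] := boolP (h _ _); first exact: X1.
    rewrite leqn0 cards_eq0; apply/eqP/setP => j; rewrite [RHS]inE.
    apply: contraNF nhl => jX; rewrite -(lastX j jX).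
    by move: jX; rewrite inE => /andP[].
  rewrite -addnA (leq_trans _ (leq_add (leqnn _) (leq_add (leqnn _) leX))) //.
  apply: leq_trans (leq_add (leqnn _) (leq_card_setU J1 X).1).
  apply: leq_trans (leq_card_setU J0 (J1 :|: X)).1.
  apply: subset_leq_card; apply/subsetP => j; rewrite !inE => ->.
  have := ltn_ord j; rewrite leq_eqVlt => /orP[->|->]; first by rewrite !orbT.
  by case: (odd j); rewrite ?orbT.
have [fullO|nfull] := boolP [forall x in O, h x (s x)]; last first.
  have := nfull; rewrite negb_forall_in => /exists_inP[z zO hz].
  have Oz : porbit s z = O by rewrite eO; apply/eqP; rewrite eq_porbit_mem -eO.
  have [|F [pF cF F2]] := split_arcs (s z).
    by rewrite -Oz -(porbit_perm s 1 z) expg1.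
  rewrite -iterSr prednK ?lt0n -?Oz ?card_porbit_neq0 // iter_porbit Oz.
  rewrite (negPf hz) addn0 => le; exists F; split=> //.
  by rewrite /odd_cycle (negPf nfull) andbF.
have [|F [pF cF F2 le]] := split_arcs x0; first by rewrite eO.
have leF := card_pair_packing pF cF F2.
have arcsO : arcs O = O.
  apply/setP => y; rewrite inE; case yO: (y \in O) => //.
  by move/forall_inP: fullO => /(_ _ yO) ->.
exists F; split=> //; rewrite /odd_cycle fullO andbT; move: le leF.
rewrite arcsO; case: (h _ _); case: ifP; clear; lia.
Qed.

Lemma full_orbit_cycle O : O \in porbits s -> {in O, forall x, h x (s x)} ->
  exists t, [/\ path.cycle h t, uniq t, size t = #|O| & t =i O].
Proof.
move=> /imsetP[x _ ->] hO; exists (traject s x #|porbit s x|).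
split; rewrite ?size_traject ?uniq_traject_porbit //; last first.
  by move=> y; rewrite -porbit_traject.
have := iter_porbit s x; have := card_porbit_neq0 s x.
case: #|_| => // n _ eqx; rewrite /=.
have -> : rcons (traject s (s x) n) x = traject s (s x) n.+1.
  by rewrite trajectSr -iterSr eqx.
suff pathO m y : y \in porbit s x -> path h y (traject s (s y) m).
  exact/pathO/porbit_id.
elim: m y => //= m IHm y yO.
have := porbit_perm s 1 y; rewrite expg1 => eqy.
by rewrite hO ?IHm // -eq_porbit_mem eqy eq_porbit_mem.
Qed.

Lemma porbits_trivIset : trivIset (porbits s).
Proof.
apply/trivIsetP => _ _ /imsetP[x _ ->] /imsetP[y _ ->] neq.
rewrite disjoints_subset; apply/subsetP => z zx; rewrite inE.
apply: contra neq => zy; rewrite eq_porbit_mem.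
by rewrite -eq_porbit_mem in zx; rewrite -eq_porbit_mem -(eqP zx) eq_porbit_mem.
Qed.

Lemma cover_porbits : cover (porbits s) = setT.
Proof.
apply/setP => x; rewrite inE; apply/bigcupP; exists (porbit s x).
  exact: imset_f.
exact: porbit_id.
Qed.

(** Cliques are nonempty, so packings inside different members of [D] share none and sums over the
    union split. *)
Lemma packing_bigcup (D : {set {set V}}) (G : {set V} -> {set {set V}})
    (P := \bigcup_(O in D) G O) :
    trivIset D ->
    {in D, forall O, packing h (G O) /\ cover (G O) \subset O} ->
  [/\ packing h P, cover P \subset cover D &
      forall E : {set V} -> nat,
        \sum_(A in P) E A = \sum_(O in D) \sum_(A in G O) E A].
Proof.
move=> tD GD; have sub O A : O \in D -> A \in G O -> A \subset O.
  by move=> /GD[_ cO] AG; apply: subset_trans cO; apply: (bigcup_sup A).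
have nz O A : O \in D -> A \in G O -> exists a, a \in A.
  move=> /GD[pG _] AG.
  by have [a [_ [aA _ _ _]]] := hclique_pair (packing_hclique pG AG); exists a.
split.
- apply/andP; split; last first.
    apply/forall_inP => A /bigcupP[O OD AG].
    by have [pG _] := GD O OD; apply: packing_hclique AG.
  apply/trivIsetP => A B /bigcupP[O OD AG] /bigcupP[O' OD' BG] neq.
  have [eqO|neqO] := eqVneq O O'.
    rewrite -eqO in BG; have [pG _] := GD O OD.
    exact: (packing_disjoint pG AG BG neq).
  by apply: disjointW (trivIsetP tD _ _ OD OD' neqO); apply: sub.
- apply/bigcupsP => A /bigcupP[O OD AG].
  by apply: subset_trans (sub _ _ OD AG) _; apply: (bigcup_sup O).
- move=> E; rewrite /P [\bigcup_(O in D) _]big_mkcond /=.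
  rewrite partition_disjoint_bigcup => [|O O' neqO].
    rewrite [RHS]big_mkcond; apply: eq_bigr => O _.
    by case: ifP => // _; rewrite big_set0.
  case: ifP => OD; last by rewrite disjoints_subset sub0set.
  case: ifP => OD'; last by rewrite disjoint_sym disjoints_subset sub0set.
  rewrite disjoints_subset; apply/subsetP => A AG; rewrite inE.
  apply/negP => AG'; have [a aA] := nz _ _ OD AG.
  have := disjointFr (trivIsetP tD _ _ OD OD' neqO).
  by move=> /(_ a (subsetP (sub _ _ OD AG) a aA));
    rewrite (subsetP (sub _ _ OD' AG') a aA).
Qed.

Lemma card_arcs_sum : #|arcs setT| = \sum_(O in porbits s) #|arcs O|.
Proof.
rewrite -sum1dep_card -cover_porbits big_trivIset_cond ?porbits_trivIset //=.
by apply: eq_bigr => O _; rewrite sum1dep_card.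
Qed.

Lemma card_pairs_sum (P : {set {set V}}) :
  #|pairs P| = \sum_(A in P) (#|A| == 2).
Proof.
rewrite -sum1dep_card big_mkcondr; apply: eq_bigr => A _ /=; by case: (_ == 2).
Qed.
End CyclePackings.

(** * From many arcs of a permutation to a large clique model *)

Section DegreeBound.
Variables (V : finType) (h g : rel V).
Hypothesis h_sym : symmetric h.
Hypothesis h_irr : irreflexive h.
Hypothesis h_sub : subrel h g.
Hypothesis g_sym : symmetric g.
Hypothesis linked : forall a b c d, h a b -> h c d ->
  [disjoint [set a; b] & [set c; d]] -> [|| g a c, g a d, g b c | g b d].

Lemma packing_sub (P Q : {set {set V}}) :
  Q \subset P -> packing h P -> packing h Q.
Proof.
move=> QP /andP[tP /forall_inP cP]; apply/andP; split; first exact: trivIsetS tP.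
by apply/forall_inP => A /(subsetP QP)/cP.
Qed.

Lemma perm_clique_model (s : {perm V}) k :
    4 <= k -> 3 * k <= #|arcs h s setT| + 5 ->
  exists K, clique_model g K /\ k <= #|K|.
Proof.
move=> k4; set D := porbits s => leN.
have /fin_all_exists[F FP] : forall O : {set V}, exists F, O \in D ->
    [/\ packing h F, cover F \subset O, forall A, A \in F -> #|A| = 2 &
    if odd_cycle h s O then #|O| = 2 * #|F| + 1 else #|arcs h s O| <= 2 * #|F|].
  move=> O; have [OD|_] := boolP (O \in D); last by exists set0.
  by have [F FP] := orbit_packing h_sym h_irr OD; exists F.
pose f O := #|F O|; pose n O := #|arcs h s O|.
have fullP O : odd_cycle h s O -> {in O, forall x, h x (s x)}.
  by move=> /andP[_ /forall_inP].
have odd_n O : O \in D -> odd_cycle h s O -> n O = 2 * f O + 1 /\ #|O| = n O.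
  move=> OD oO; have [_ _ _] := FP O OD; rewrite oO => <-.
  suff -> : n O = #|O| by [].
  congr #|pred_of_set _|; apply/setP => x; rewrite inE.
  by case xO: (x \in O) => //=; rewrite (fullP O oO).
have odd_f O : O \in D -> odd_cycle h s O -> 0 < f O.
  move=> OD oO; have [nO cO] := odd_n O OD oO.
  rewrite lt0n; apply/eqP => f0; have /eqP/cards1P[x eO] : #|O| = 1.
    by rewrite cO nO f0.
  have := fullP O oO x; rewrite eO set11 => /(_ isT).
  have [y _ eO'] := imsetP OD; have xy : x \in porbit s y by rewrite -eO' eO set11.
  have sxO : s x \in O.
    rewrite eO' -eq_porbit_mem -(expg1 s) porbit_perm expg1.
    by rewrite eq_porbit_mem.
  by move: sxO; rewrite eO inE => /eqP->; rewrite h_irr.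
have even_n O : O \in D -> ~~ odd_cycle h s O -> n O <= 2 * f O.
  by move=> OD /negPf oO; have [_ _ _] := FP O OD; rewrite oO.
have n3 O : O \in D -> n O <= 3 * f O.
  move=> OD; have [oO|eO] := boolP (odd_cycle h s O).
    by have := odd_f O OD oO; have [-> _] := odd_n O OD oO; clear; lia.
  by apply: leq_trans (even_n O OD eO) _; rewrite leq_mul2r orbT.
have tD : trivIset D := porbits_trivIset s.
have [lek|ltk] := leqP k (\sum_(O in D) f O).
  have [|pP _ EP] := @packing_bigcup _ h D F tD.
    by move=> O /FP[].
  exists (\bigcup_(O in D) F O); split.
    exact: (packing_clique_model h_sub linked pP).
  rewrite -sum1_card EP (leq_trans lek) // leq_sum // => O _.
  by rewrite sum1_card.
(* [d O] is the slack of [O] in N <= 3 * (number of matching edges); the slacks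
   add up to at most 2, and a cycle of length 2f+1 has slack f - 1. *)
pose d O := 3 * f O - n O.
have sumd : \sum_(O in D) d O + \sum_(O in D) n O = 3 * \sum_(O in D) f O.
  by rewrite big_distrr -big_split; apply: eq_bigr => O OD; rewrite /= subnK ?n3.
have sumn : \sum_(O in D) n O = #|arcs h s setT|.
  exact/esym/card_arcs_sum.
(* Fewer than [k - 1] matching edges would allow at most [3 * k - 6] arcs. So there are [k - 1],
   with total slack at most [3 * (k - 1) - (3 * k - 5) = 2]. *)
have [leD eqk] : \sum_(O in D) d O <= 2 /\ k = \sum_(O in D) f O + 1.
  by move: sumd sumn leN ltk; clear; lia.
pose tri O := odd_cycle h s O && (f O == 1).
(* A triangle enters the packing whole rather than as one of its edges: the number of cliques is the
   same, and it can lend a vertex to a star. *)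
pose G O := if tri O then [set O] else F O.
pose p O := if tri O then 0 else f O.
have triC O : O \in D -> odd_cycle h s O -> f O = 1 ->
    exists a b c, [/\ h a b, h b c, h c a & O = [set a; b; c]].
  move=> OD oO f1; have [nO cO] := odd_n O OD oO.
  have [t [cyc un st eO]] := full_orbit_cycle OD (fullP O oO).
  move: cyc un st eO; rewrite cO nO f1.
  case: t => [//|a [//|b [//|c [|//]]]] /and4P[hab hbc hca _] _ _ eO.
  by exists a, b, c; split=> //; apply/setP => x; rewrite -eO !inE orbA.
have GP O : O \in D -> [/\ packing h (G O), cover (G O) \subset O,
    \sum_(A in G O) 1 = f O & \sum_(A in G O) (#|A| == 2) = p O].
  move=> OD; rewrite /G /p; case: ifP => [/andP[oO /eqP f1]|_].
    have [nO cO] := odd_n O OD oO.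
    have [a [b [c [hab hbc hca eO]]]] := triC O OD oO f1.
    split.
    - apply/andP; split; first exact: trivIset1.
      apply/forall_inP => A; rewrite inE => /eqP->; rewrite eO.
      exact: hclique3.
    - by rewrite /cover big_set1.
    - by rewrite big_set1 f1.
    - by rewrite big_set1 cO nO f1.
  have [pF cF F2 _] := FP O OD; split=> //; first by rewrite sum1_card.
  by rewrite /f -sum1_card; apply: eq_bigr => A /F2->.
have PP C : C \in D -> exists P, [/\ packing h P,
    {in C, forall x, x \notin cover P}, #|P| + f C = \sum_(O in D) f O &
    #|pairs P| = \sum_(O in D :\ C) p O].
  move=> CD; have [||pP cP EP] := @packing_bigcup _ h (D :\ C) G.
  - exact: trivIsetD.
  - by move=> O /setD1P[_ /GP[]].
  exists (\bigcup_(O in D :\ C) G O); split=> //.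
  - move=> x xC; apply: contraL (xC) => /(subsetP cP).
    by rewrite coverD1 // inE => /andP[].
  - rewrite -sum1_card EP addnC [RHS](big_setD1 C) //=; congr (_ + _).
    by apply: eq_bigr => O /setD1P[_ /GP[]].
  - by rewrite card_pairs_sum EP; apply: eq_bigr => O /setD1P[_ /GP[]].
have split_d C (E : {set V} -> nat) : C \in D ->
    \sum_(O in D) E O = E C + \sum_(O in D :\ C) E O.
  by move=> CD; rewrite (big_setD1 C).
(* Slack at most 2 makes an odd cycle longer than a triangle a pentagon or a heptagon. *)
have [/exists_inP[C CD /andP[oC f2]]|] :=
    boolP [exists C in D, odd_cycle h s C && (1 < f C)].
  have [P [pP outP cP prP]] := PP C CD; have [nC cC] := odd_n C CD oC.
  (* A cycle that is not a triangle contributes [f O] pairs; its slack is [f O - 1] with [f O >= 2]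
     if it is odd, and at least [f O] otherwise. *)
  have le_pd : #|pairs P| <= 2 * \sum_(O in D :\ C) d O.
    rewrite prP big_distrr leq_sum // => O /setD1P[_ OD] /=.
    rewrite /p /tri /d; have [oO|eO] := boolP (odd_cycle h s O) => /=.
      have [-> _] := odd_n O OD oO; have := odd_f O OD oO.
      by case: eqP; clear; lia.
    by have := even_n O OD eO; clear; lia.
  have dC : d C = f C - 1 by rewrite /d nC; clear; lia.
  have := split_d C d CD; rewrite dC => sd.
  have [t [cyc un st eC]] := full_orbit_cycle CD (fullP C oC).
  have outt : {in t, forall v, v \notin cover P} by move=> v; rewrite eC => /outP.
  have [f3|fn3] := eqVneq (f C) 3; last first.
    have f2' : f C = 2 by move: fn3 f2 sd leD; clear; lia.
    have [||K [mK cK]] :=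
        pentagon_clique_model h_sym h_irr h_sub g_sym linked pP cyc un outt.
    - by rewrite st cC nC f2'.
    - by move: le_pd sd leD f2'; clear; lia.
    - by exists K; split=> //; rewrite cK eqk -cP f2'; clear; lia.
  (* The heptagon uses up the whole slack, so the other cycles contribute no pair. *)
  have prP0 : pairs P = set0.
    by apply: cards0_eq; move: le_pd sd leD f3; clear; lia.
  have st7 : size t = 7 by rewrite st cC nC f3.
  have [T TP|P0] := pickP (mem P); last first.
    have [K [mK cK]] :=
      heptagon_clique_model h_sym h_irr h_sub g_sym linked cyc un st7.
    by exists K; rewrite cK eqk -cP f3 (eq_card0 P0).
  have {}TP : T \in P := TP; have cT := packing_hclique pP TP.
  have T3 : 2 < #|T|.
    have /andP[+ _] := cT; rewrite leq_eqVlt => /orP[/eqP T2|//].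
    have : T \in pairs P by rewrite inE -T2 eqxx andbT.
    by rewrite prP0 inE.
  have /card_gt2P[a [b [c [[aT bT cT'] [ab bc ca]]]]] := T3.
  (* [T] leaves the packing so that its vertices can be centres of stars. *)
  have pPT : packing h (P :\ T) by apply: packing_sub pP; apply: subsetDl.
  have cov : cover (P :\ T) = cover P :\: T.
    by rewrite coverD1 // (packing_trivIset pP).
  have outT x : x \in T -> x \notin cover (P :\ T) by rewrite cov inE => ->.
  have nt x : x \in T -> x \notin t.
    move=> xT; apply/negP => /outt; apply/negP; rewrite negbK.
    by apply/bigcupP; exists T.
  have [||||||||||K [mK cK]] := @triangle_heptagon_clique_model _ _ _
      h_sym h_irr h_sub g_sym linked (P :\ T) a b c t pPT.
  - apply/eqP; rewrite -subset0 -prP0; apply/subsetP => A.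
    by rewrite !inE => /andP[/andP[_ ->]].
  - exact: (hcliqueP cT aT bT ab).
  - exact: (hcliqueP cT bT cT' bc).
  - exact: (hcliqueP cT cT' aT ca).
  - exact: cyc.
  - exact: un.
  - exact: st7.
  - by move=> v /outt; rewrite cov inE => /negPf->; rewrite andbF.
  - by rewrite !outT.
  - by rewrite !nt.
  exists K; split=> //; rewrite cK eqk -cP f3 (cardsD1 T P) TP; clear; lia.
rewrite negb_exists_in => /forall_inP small.
have f1 O : O \in D -> odd_cycle h s O -> f O = 1.
  move=> OD oO; have := small O OD; rewrite oO -leqNgt => le1.
  by apply/eqP; rewrite eqn_leq le1 odd_f.
(* Without odd cycles there would be at most [2 * (k - 1)] arcs, fewer than [3 * k - 5] since
   [k >= 4]. *)
have [/exists_inP[C CD oC]|] := boolP [exists C in D, odd_cycle h s C]; last first.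
  rewrite negb_exists_in => /forall_inP even.
  have : \sum_(O in D) n O <= 2 * \sum_(O in D) f O.
    by rewrite big_distrr leq_sum // => O OD; apply: even_n => //; apply: even.
  by move: leN sumn eqk k4; clear; lia.
have [P [pP outP cP prP]] := PP C CD.
have [a [b [c [hab hbc hca eC]]]] := triC C CD oC (f1 C CD oC).
have prP2 : #|pairs P| <= 2.
  apply: leq_trans leD; rewrite (split_d C d CD) prP.
  apply: leq_trans (leq_addl _ _); rewrite leq_sum // => O /setD1P[_ OD].
  rewrite /p /tri /d; have [oO|eO] := boolP (odd_cycle h s O) => /=.
    by rewrite f1.
  by have := even_n O OD eO; clear; lia.
have [|||||K [mK cK]] :=
    triangle_clique_model h_sym h_irr h_sub g_sym linked pP hab hbc hca.
- by apply: outP; rewrite eC !inE eqxx.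
- by apply: outP; rewrite eC !inE eqxx orbT.
- by apply: outP; rewrite eC !inE eqxx !orbT.
- exact: leqW.
- by left.
exists K; split=> //; rewrite cK eqk -cP f1 //; clear; lia.
Qed.
End DegreeBound.

(** * The support of a strong clique and the degree bound *)

Section StrongClique.
Variable G : multigraph.
Implicit Types (S : {set edge G}).

Definition support S : rel (vertex G) :=
  fun u v => [exists e in S, ends e == [set u; v]].

Lemma support_sym S : symmetric (support S).
Proof. by move=> u v; apply: eq_existsb => e; rewrite setUC. Qed.

Lemma support_sub S : subrel (support S) (@underlying G).
Proof.
by move=> u v /exists_inP[e _ eP]; apply/existsP; exists e.
Qed.

Lemma support_irr S : irreflexive (support S).
Proof.
by move=> u; apply: contraFF (underlying_irrefl u); apply: support_sub.
Qed.

(** The joining edge meets two disjoint sets and has only two ends, so it has exactly one in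
    each. *)
Lemma joined_underlying (e f : edge G) : joined e f ->
    [disjoint ends e & ends f] ->
  exists x y, [/\ x \in ends e, y \in ends f & underlying x y].
Proof.
move=> /existsP[g /andP[/set0Pn[x /setIP[xg xe]] /set0Pn[y /setIP[yg yf]]]] dis.
exists x, y; split=> //; apply/existsP; exists g; rewrite eq_sym eqEcard.
have xy : x != y by apply: contraTneq yf => <-; rewrite (disjointFr dis).
rewrite cards2 xy card_ends leqnn andbT; apply/subsetP => z.
by rewrite !inE => /orP[] /eqP->.
Qed.

Lemma support_linked S : strong_clique S -> forall a b c d,
    support S a b -> support S c d -> [disjoint [set a; b] & [set c; d]] ->
  [|| underlying a c, underlying a d, underlying b c | underlying b d].
Proof.
move=> scS a b c d /exists_inP[e eS /eqP eab] /exists_inP[f fS /eqP fcd] dis.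
have dis' : [disjoint ends e & ends f] by rewrite eab fcd.
have ef : e != f.
  apply: contraTneq dis' => ->; rewrite -setI_eq0 setIid fcd.
  by apply/set0Pn; exists c; rewrite !inE eqxx.
move/forall_inP: scS => /(_ e eS)/forall_inP/(_ f fS); rewrite ef /=.
rewrite /incident setI_eq0 dis' /= => /joined_underlying/(_ dis').
move=> [x [y [+ + uxy]]]; rewrite eab fcd !inE.
by move=> /orP[] /eqP xE /orP[] /eqP yE; move: uxy; rewrite xE yE => ->;
  rewrite ?orbT.
Qed.

Lemma sum_ends_mem S (A : {set vertex G}) (Delta : nat) :
    max_degree G <= Delta ->
  \sum_(e in S) #|ends e :&: A| <= #|A| * Delta.
Proof.
move=> leD; rewrite -sum_nat_const.
have -> : \sum_(e in S) #|ends e :&: A|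
    = \sum_(v in A) \sum_(e in S) (v \in ends e).
  rewrite exchange_big; apply: eq_bigr => e _.
  rewrite -sum1_card big_mkcond [RHS]big_mkcond; apply: eq_bigr => v _.
  by rewrite inE andbC; case: (v \in A); case: (v \in _).
apply: leq_sum => v _; apply: leq_trans leD.
apply: leq_trans (leq_bigmax v); rewrite /degree -sum1dep_card.
rewrite big_mkcond [leqRHS]big_mkcond; apply: leq_sum => e _.
by case: (e \in S); case: (v \in _).
Qed.

(** The ordered pairs of adjacent vertices are the edges of the bipartite double cover of the
    support. Either its matching [M] is small enough for the degree bound, or it extends to a
    permutation with at least [3 * k - 5] arcs, which yields the excluded minor. *)
Lemma strong_clique_bound S k : 4 <= k -> K_minor_free k G -> strong_clique S ->
  2 * #|S| <= 3 * (k - 2) * max_degree G.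
Proof.
move=> k4 free scS; pose h := support S.
have [M [A [B [ME M1 M2 cAB leAB]]]] := konig [set p | h p.1 p.2].
have leS : 2 * #|S| <= #|M| * max_degree G.
  (* The cover meets both orientations of an edge of [S], so [A] and [B] together count its ends at
     least twice. *)
  have le2 : 2 * #|S| <= \sum_(e in S) (#|ends e :&: A| + #|ends e :&: B|).
    rewrite mulnC -sum_nat_const leq_sum // => e eS.
    have /eqP/cards2P[x [y [xy exy]]] := card_ends e.
    have hxy : h x y by apply/exists_inP; exists e; rewrite ?exy.
    have hyx : h y x by rewrite /h support_sym.
    have := forall_inP cAB (x, y); have := forall_inP cAB (y, x).
    rewrite !inE /= hxy hyx => /(_ isT) c1 /(_ isT) c2.
    have cI (C : {set vertex G}) : #|ends e :&: C| = (x \in C) + (y \in C).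
      rewrite exy -sum1_card -big_filter.
      rewrite big_filter (eq_bigl (fun z => (z \in [set x; y]) && (z \in C))).
        rewrite big_mkcondr big_setU1 ?inE // big_set1 /=.
        by case: (x \in C); case: (y \in C).
      by move=> z; rewrite in_setI.
    rewrite !cI; move: c1 c2.
    by case: (x \in A); case: (y \in A); case: (x \in B); case: (y \in B).
  apply: leq_trans le2 _; rewrite big_split /=.
  apply: leq_trans (leq_add (sum_ends_mem _ _ (leqnn _))
    (sum_ends_mem _ _ (leqnn _))) _.
  by rewrite -mulnDl leq_mul2r leAB orbT.
have [le|lt] := leqP #|M| (3 * (k - 2)).
  by apply: leq_trans leS _; rewrite leq_mul2r le orbT.
have [s sM] := perm_extends M1 M2.
have leM : #|M| <= #|arcs h s setT|.
  rewrite -(card_in_imset M1); apply: subset_leq_card.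
  apply/subsetP => _ /imsetP[[x y] xyM ->]; rewrite !inE (sM x y) //=.
  by have := subsetP ME _ xyM; rewrite inE.
have [|K [mK leK]] := perm_clique_model (support_sym S) (support_irr S)
  (@support_sub S) (@underlying_sym G) (support_linked scS) (s := s) k4.
  by apply: leq_trans (leq_add leM (leqnn 5)); move: lt k4; clear; lia.
by case: free; apply: clique_model_minor mK leK.
Qed.
End StrongClique.

(** * The bound over the rational numbers *)

Import Order.TTheory GRing.Theory Num.Theory.
Local Open Scope ring_scope.

Theorem theorem1p7 (k : nat) (hk : (4 <= k)%N) (G : multigraph) (Delta : nat)
  (hfree : K_minor_free k G) (hDelta : max_degree G = Delta) :
  (strong_clique_number G)%:R <= 3 / 2 * (k%:R - 2) * Delta%:R :> rat.
Proof.
have : (2 * strong_clique_number G <= 3 * (k - 2) * Delta)%N.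
  rewrite -hDelta mulnC -leq_divRL //; apply/bigmax_leqP => S scS.
  by rewrite leq_divRL // mulnC strong_clique_bound.
(* As [2 <= k], the truncated [k - 2] agrees with the rational difference. *)
rewrite -(ler_nat rat) !natrM natrB ?(leq_trans _ hk) //; lra.
Qed.
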